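(* Let $(X_{\alpha},\delta_{\alpha})_{\alpha\in I}$ be a collection of separated proximity spaces and let $(\coprod_{\alpha}X_{\alpha},\delta)$ be the associated coproduct. For each $\alpha$ let $(\mathfrak{X}_{\alpha},\delta_{\alpha}^{*})$ denote the Smirnov compactification of $(X_{\alpha},\delta_{\alpha})$, and let $(\overline{\coprod_{\alpha}X_{\alpha}},\delta^{*})$ denote the Smirnov compactification of the coproduct $(\coprod_{\alpha}X_{\alpha},\delta)$. Then $$(\coprod_{\alpha}\mathfrak{X}_{\alpha},\delta_{1})\hookrightarrow(\overline{\coprod_{\alpha}X_{\alpha}},\delta^{*}),$$ where $\delta_{1}$ is the proximity associated to the coproduct of the collection of proximity spaces $(\mathfrak{X}_{\alpha},\delta_{\alpha}^{*})_{\alpha\in I}$, and $\hookrightarrow$ denotes a dense proximity embedding. Moreover, the dense proximity embedding is a proximity isomorphism if and only if the index set $I$ is finite. In other words, the coproduct of the Smirnov compactifications is the Smirnov compactification of the coproduct if and only if the index set $I$ is finite.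
   Context: A proximity on a set $X$ is a binary relation $\delta$ on the power set of $X$ such that for all $A,B,C\subseteq X$: (1) $A\delta B\Rightarrow B\delta A$; (2) $A\delta B\Rightarrow A,B\neq\emptyset$; (3) $A\cap B\neq\emptyset\Rightarrow A\delta B$; (4) $A\delta(B\cup C)\iff A\delta B$ or $A\delta C$; (5) if not $A\delta B$, then there is $E\subseteq X$ with not $A\delta E$ and not $(X\setminus E)\delta B$. The pair $(X,\delta)$ is called a proximity space. It is separated if, for all $x,y\in X$, $\{x\}\delta\{y\}\iff x=y$. It induces a topology on $X$: $A$ is closed iff ($\{x\}\delta A$ implies $x\in A$). A map $f:(X,\delta_X)\to(Y,\delta_Y)$ is a proximity map if $A\delta_X B$ implies $f(A)\delta_Y f(B)$; a proximity isomorphism is a bijective proximity map whose inverse is a proximity map; a proximity embedding is a proximity isomorphism onto a subspace of the target (the subspace proximity on $Z\subseteq Y$ is the restriction of $\delta_Y$ to subsets of $Z$). It is dense if its image is dense in the induced topology. The coproduct of proximity spaces $(X_\alpha,\delta_\alpha)_{\alpha\in I}$ ($I$ an arbitrary index set: finite, countable or uncountable) is the disjoint union $\coprod_\alpha X_\alpha$ with the proximity $A\delta B\iff A_\alpha\delta_\alpha B_\alpha$ for some $\alpha$, where $A_\alpha:=A\cap X_\alpha$. A cluster in a separated proximity space $(X,\delta)$ is a nonempty collection $\sigma$ of subsets of $X$ such that: (1) $A\delta B$ for all $A,B\in\sigma$; (2) if $C\delta A$ for all $A\in\sigma$ then $C\in\sigma$; (3) if $A\cup B\in\sigma$ then $A\in\sigma$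 or $B\in\sigma$. Let $\mathfrak{X}$ be the set of all clusters in $X$; a set $C\subseteq X$ absorbs $\mathcal{A}\subseteq\mathfrak{X}$ if $C\in\sigma$ for every $\sigma\in\mathcal{A}$. Define $\mathcal{A}\delta^{*}\mathcal{B}$ iff $A\delta B$ for all $A,B\subseteq X$ absorbing $\mathcal{A},\mathcal{B}$ respectively. Then $\delta^{*}$ is a proximity on $\mathfrak{X}$ whose induced topology is compact and Hausdorff, and $(\mathfrak{X},\delta^{*})$ is called the Smirnov compactification of $(X,\delta)$; $X$ embeds in it proximally and densely by sending each point $x$ to its point cluster $\{A\subseteq X:\{x\}\delta A\}$, and it is the unique (up to proximity isomorphism) compact Hausdorff space into which $X$ proximally and densely embeds.
   Formalization: The ''if and only if'' claims assume every X_α nonempty: if I is infinite and all X_α are empty, both sides are empty and the embedding is an isomorphism. The dense embedding, and that it is an isomorphism for finite I, are stated without this assumption. *)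

(* Defs.v *)
From HB Require Import structures.
From mathcomp Require Import all_boot.
From mathcomp Require Import boolp classical_sets functions cardinality.
From mathcomp Require Import topology.

Set Implicit Arguments.
Unset Strict Implicit.
Unset Printing Implicit Defensive.

Local Open Scope classical_set_scope.

HB.mixin Record isProximity (X : Type) := {
  prox : set X -> set X -> Prop;
  prox_sym : forall A B, prox A B -> prox B A;
  prox_nonempty : forall A B, prox A B -> A !=set0 /\ B !=set0;
  prox_meet : forall A B, A `&` B !=set0 -> prox A B;
  proxU : forall A B C, prox A (B `|` C) <-> prox A B \/ prox A C;
  prox_strong : forall A B, ~ prox A B ->
    exists E, ~ prox A E /\ ~ prox (~` E) B
}.

#[short(type="proximityType")]
HB.structure Definition Proximity := {X of isProximity X}.

Arguments prox_sym {s A B} _.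
Arguments prox_nonempty {s A B} _.
Arguments prox_meet {s A B} _.
Arguments proxU {s A B C}.
Arguments prox_strong {s A B} _.

Definition separated_prox (X : proximityType) : Prop :=
  forall x y : X, prox [set x] [set y] <-> x = y.

Lemma prox_sub (X : proximityType) (A B C D : set X) :
  A `<=` B -> C `<=` D -> prox A C -> prox B D.
Proof.
have mono (A' B' C' : set X) : B' `<=` C' -> prox A' B' -> prox A' C'.
  move=> sub AB; have <- : B' `|` C' = C' by exact/setUidPr.
  by apply/proxU; left.
move=> AB CD AC; apply: (mono _ C) => //; apply: prox_sym.
by apply: (mono _ A) => //; exact: prox_sym.
Qed.

(* An alias of X carrying the topology induced by the proximity of X. *)
Definition prox_space (X : Type) : Type := X.

HB.instance Definition _ (X : Type) := gen_eqMixin (prox_space X).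
HB.instance Definition _ (X : Type) := gen_choiceMixin (prox_space X).

Definition prox_closed (X : proximityType) (A : set X) : Prop :=
  forall x, prox [set x] A -> A x.

Definition prox_open (X : proximityType) : set (set (prox_space X)) :=
  [set A : set X | prox_closed (~` A)].

Section InducedTopology.
Variable X : proximityType.

Let openT : prox_open [set: prox_space X].
Proof.
move=> x xP.
by have [_ [y nTy]] := prox_nonempty xP; case: (nTy I).
Qed.

Let openI : setI_closed (@prox_open X).
Proof.
move=> A B oA oB x; rewrite setCI => /proxU[xA|xB].
- by left; exact: oA.
- by right; exact: oB.
Qed.

Let open_bigU (I : Type) (f : I -> set (prox_space X)) :
  (forall i, prox_open (f i)) -> prox_open (\bigcup_i f i).
Proof.
move=> of_ x xP [i _ fix_]; apply: (of_ i x) fix_.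
by apply: prox_sub xP => // y nfy fiy; apply: nfy; exists i.
Qed.

HB.instance Definition _ :=
  isOpenTopological.Build (prox_space X) openT openI open_bigU.

Lemma closed_proxE (A : set X) :
  closed (A : set (prox_space X)) <-> prox_closed A.
Proof. by rewrite -openC /open/= /prox_open/= setCK. Qed.

End InducedTopology.

Definition proximity_map (X Y : proximityType) (f : X -> Y) : Prop :=
  forall A B : set X, prox A B -> prox (f @` A) (f @` B).

Definition proximity_isomorphism (X Y : proximityType) (f : X -> Y) : Prop :=
  exists g : Y -> X,
    [/\ cancel f g, cancel g f, proximity_map f & proximity_map g].

Section Subspace.
Variables (Y : proximityType) (Z : set Y).
Implicit Types A B C : set Z.

Definition sub_prox A B : Prop := prox (set_val @` A) (set_val @` B).

Let sub_prox_sym A B : sub_prox A B -> sub_prox B A.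
Proof. exact: prox_sym. Qed.

Let sub_prox_nonempty A B : sub_prox A B -> A !=set0 /\ B !=set0.
Proof.
by move=> /prox_nonempty[[_ [a Aa _]] [_ [b Bb _]]]; split; [exists a|exists b].
Qed.

Let sub_prox_meet A B : A `&` B !=set0 -> sub_prox A B.
Proof.
by move=> [z [Az Bz]]; apply: prox_meet; exists (set_val z); split; exists z.
Qed.

Let sub_proxU A B C :
  sub_prox A (B `|` C) <-> sub_prox A B \/ sub_prox A C.
Proof. by rewrite /sub_prox image_setU; exact: proxU. Qed.

Let sub_prox_strong A B : ~ sub_prox A B ->
  exists E, ~ sub_prox A E /\ ~ sub_prox (~` E) B.
Proof.
move=> /prox_strong[E [AE EB]]; exists (set_val @^-1` E); split.
- by move=> h; apply: AE; apply: prox_sub h => // _ [z Ez <-].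
- by move=> h; apply: EB; apply: prox_sub h => // _ [z Ez <-].
Qed.

HB.instance Definition _ := isProximity.Build (set_type Z)
  sub_prox_sym sub_prox_nonempty sub_prox_meet sub_proxU sub_prox_strong.

End Subspace.

Definition proximity_embedding (X Y : proximityType) (f : X -> Y) : Prop :=
  exists (Z : set Y) (g : X -> set_type Z),
    proximity_isomorphism g /\ f = set_val \o g.

Definition dense_proximity_embedding (X Y : proximityType) (f : X -> Y) : Prop :=
  proximity_embedding f /\ dense (range f : set (prox_space Y)).

Definition coproduct (I : Type) (X : I -> proximityType) : Type := {a : I & X a}.

Section Coproduct.
Variables (I : Type) (X : I -> proximityType).
Implicit Types A B C : set (coproduct X).

Definition summand A (a : I) : set (X a) := [set x | A (existT _ a x)].
Arguments summand A a : clear implicits.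

Definition coprod_prox A B : Prop := exists a, prox (summand A a) (summand B a).

Let coprod_prox_sym A B : coprod_prox A B -> coprod_prox B A.
Proof. by move=> [a /prox_sym ?]; exists a. Qed.

Let coprod_prox_nonempty A B : coprod_prox A B -> A !=set0 /\ B !=set0.
Proof.
by move=> [a /prox_nonempty[[x Ax] [y By]]]; split; eexists; [exact: Ax|exact: By].
Qed.

Let coprod_prox_meet A B : A `&` B !=set0 -> coprod_prox A B.
Proof. by move=> [[a x] [Ax Bx]]; exists a; apply: prox_meet; exists x. Qed.

Let coprod_proxU A B C :
  coprod_prox A (B `|` C) <-> coprod_prox A B \/ coprod_prox A C.
Proof.
split.
- by move=> [a /proxU[?|?]]; [left|right]; exists a.
- by move=> [|] [a h]; exists a; apply/proxU; [left|right].
Qed.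

Let coprod_prox_strong A B : ~ coprod_prox A B ->
  exists E, ~ coprod_prox A E /\ ~ coprod_prox (~` E) B.
Proof.
move=> nAB.
have nABa a : ~ prox (summand A a) (summand B a) by move=> h; apply: nAB; exists a.
pose E a := projT1 (cid (prox_strong (nABa a))).
exists [set u | E (projT1 u) (projT2 u)].
by split=> -[a]; rewrite /E; have [? ?] := projT2 (cid (prox_strong (nABa a))).
Qed.

HB.instance Definition _ := isProximity.Build (coproduct X)
  coprod_prox_sym coprod_prox_nonempty coprod_prox_meet
  coprod_proxU coprod_prox_strong.

End Coproduct.

Record is_cluster (X : proximityType) (s : set (set X)) : Prop := IsCluster {
  cluster_nonempty : s !=set0;
  cluster_prox : forall A B, s A -> s B -> prox A B;
  cluster_max : forall C, (forall A, s A -> prox C A) -> s C;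
  cluster_prime : forall A B, s (A `|` B) -> s A \/ s B
}.

Record smirnov (X : proximityType) : Type := Cluster {
  cluster_sets :> set X -> Prop;
  cluster_sets_is_cluster : is_cluster cluster_sets
}.

Section Smirnov.
Variable X : proximityType.
Implicit Types (F G H : set (smirnov X)) (s : smirnov X) (A B C E : set X).

Definition absorbs C F : Prop := forall s, F s -> s C.

Definition smirnov_prox F G : Prop :=
  forall A B, absorbs A F -> absorbs B G -> prox A B.

Lemma cluster_sub s A B : A `<=` B -> s A -> s B.
Proof.
case: s => s [_ sP sM _] /= AB sA; apply: sM => C sC.
by apply: prox_sub (sP _ _ sA sC).
Qed.

Lemma cluster_far s A E : s A -> ~ prox A E -> s (~` E).
Proof.
case: s => s [_ sP sM sU] /= sA nAE.
have [sE|//] : s E \/ s (~` E); last by case: nAE; exact: sP.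
apply: sU; rewrite setUv; apply: sM => C sC.
by apply: (@prox_sub _ C _ C) => //; exact: sP.
Qed.

Let smirnov_prox_sym F G : smirnov_prox F G -> smirnov_prox G F.
Proof. by move=> FG A B AG BF; apply: prox_sym; exact: FG. Qed.

Let smirnov_prox_nonempty F G : smirnov_prox F G -> F !=set0 /\ G !=set0.
Proof.
have sT s : s [set: X].
  by have [[A sA] _ _ _] := cluster_sets_is_cluster s; apply: cluster_sub sA.
move=> FG; split; apply/set0P/negP => /eqP E0; subst.
- have /prox_nonempty[[? //]] : prox set0 [set: X].
  by apply: FG => // s.
- have /prox_nonempty[_ [? //]] : prox [set: X] set0.
  by apply: FG => // s.
Qed.

Let smirnov_prox_meet F G : F `&` G !=set0 -> smirnov_prox F G.
Proof.
move=> [s [Fs Gs]] A B AF BG.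
by apply: (cluster_prox (cluster_sets_is_cluster s)); [exact: AF|exact: BG].
Qed.

Let smirnov_proxU F G H :
  smirnov_prox F (G `|` H) <-> smirnov_prox F G \/ smirnov_prox F H.
Proof.
split; last first.
  by move=> [FG A B AF BGH|FH A B AF BGH]; [apply: FG|apply: FH] => // s ?;
    apply: BGH; [left|right].
move=> FGH; apply: contrapT => /not_orP[].
move=> /existsNP[A /existsNP[B /not_implyP[AF /not_implyP[BG nAB]]]].
move=> /existsNP[A' /existsNP[C /not_implyP[AF' /not_implyP[CH nAC]]]].
have [E [AE EB]] := prox_strong nAB; have [E' [AE' EC]] := prox_strong nAC.
have : prox (~` (E `|` E')) (B `|` C).
  apply: FGH => s.
  - move=> Fs; have [EE|//] : s (E `|` E') \/ s (~` (E `|` E')).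
      apply: (cluster_prime (cluster_sets_is_cluster s)).
      by rewrite setUv; apply: cluster_sub (AF s Fs).
    have [sE|sE] := cluster_prime (cluster_sets_is_cluster s) EE.
    + by case: AE; apply: (cluster_prox (cluster_sets_is_cluster s)) => //; exact: AF.
    + by case: AE'; apply: (cluster_prox (cluster_sets_is_cluster s)) => //; exact: AF'.
  - by move=> [Gs|Hs]; [apply: cluster_sub (BG s Gs)|apply: cluster_sub (CH s Hs)] => x ?;
      [left|right].
by move=> /proxU[h|h]; [apply: EB|apply: EC]; apply: prox_sub h => // x nEE Ex;
  apply: nEE; [left|right].
Qed.

Let smirnov_prox_strong F G : ~ smirnov_prox F G ->
  exists H, ~ smirnov_prox F H /\ ~ smirnov_prox (~` H) G.
Proof.
move=> /existsNP[A /existsNP[B /not_implyP[AF /not_implyP[BG nAB]]]].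
have [E [AE EB]] := prox_strong nAB.
exists [set s | s E]; split=> h; first by apply: AE; exact: h.
apply: EB; apply: h => // s nsE.
have [//|//] : s E \/ s (~` E).
apply: (cluster_prime (cluster_sets_is_cluster s)); rewrite setUv.
have [[D sD] _ _ _] := cluster_sets_is_cluster s.
by apply: cluster_sub sD.
Qed.

HB.instance Definition _ := isProximity.Build (smirnov X)
  smirnov_prox_sym smirnov_prox_nonempty smirnov_prox_meet
  smirnov_proxU smirnov_prox_strong.

End Smirnov.

(* Main.v *)
Require Import Defs.
From mathcomp Require Import all_boot.
From mathcomp Require Import boolp classical_sets functions cardinality topology.

Local Open Scope classical_set_scope.

(** A cluster [s] of a summand [X a] extends to the cluster of all sets of the
    coproduct whose trace on [X a] belongs to [s].  This map from the coproduct
    of the compactifications preserves and reflects nearness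
    ([coprod_cluster_prox]): two families of extended clusters are far as soon
    as on each summand they are absorbed by two far sets, and those sets can be
    glued, nearness in a coproduct being tested on one summand at a time.  As
    the compactifications are separated, reflecting nearness forces
    injectivity, so the map is an embedding.  It is dense because its image
    contains the point clusters and a set near every point is near every
    nonempty set ([prox_pointwise]).

    If the index set is finite, every cluster of the coproduct contains a whole
    summand, since clusters are prime for finite unions ([cluster_piece]), and
    it is then the extension of its trace on that summand; so the map is onto.

    If the index set is infinite and the summands are nonempty, no isomorphism
    of any kind exists.  It would split the Smirnov compactification of some
    space into infinitely many pieces, any two unions of disjoint families of
    pieces being far from each other.  Compactness forbids this, in the
    following direct form ([smirnov_finite_labels]).  Points of the space meet
    all pieces by density; an ultrafilter on the space that contains the
    complement of every piece generates a cluster ([ultra_cluster]), and that cluster is near the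
    points outside the very piece that contains it. *)

(** * Nearness and clusters *)

(** If [A] and [B] are far, [A] is far from some [E] whose complement is far
    from [B]; being near the points of [D], [B] leaves no point of [D] outside
    [E], and [A] would be far from [D]. *)
Lemma prox_pointwise (X : proximityType) (A B D : set X) :
  (forall z, D z -> prox [set z] B) -> prox A D -> prox A B.
Proof.
move=> DB AD; apply: contrapT => /prox_strong[E [AE EB]].
apply: AE; apply: prox_sub AD => // z Dz; apply: contrapT => nEz.
by apply: EB; apply: prox_sub (DB z Dz) => // _ ->.
Qed.

Lemma sub_proxP (Y : proximityType) (Z : set Y) (A B : set (set_type Z)) :
  prox A B <-> prox (set_val @` A) (set_val @` B).
Proof. by []. Qed.

Lemma smirnov_proxP (X : proximityType) (F G : set (smirnov X)) :
  prox F G <-> smirnov_prox F G.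
Proof. by []. Qed.

Lemma coprod_proxP (I : Type) (X : I -> proximityType) (A B : set (coproduct X)) :
  prox A B <-> coprod_prox A B.
Proof. by []. Qed.

Lemma cluster_setT (X : proximityType) (s : smirnov X) : s [set: X].
Proof.
by have [[A sA] _ _ _] := cluster_sets_is_cluster s; apply: cluster_sub sA.
Qed.

(** Two comparable clusters coincide because clusters are maximal, so it is
    enough that near clusters have pairwise near members. *)
Lemma smirnov_separated (X : proximityType) : separated_prox (smirnov X).
Proof.
move=> s t; split=> [st|->]; last by apply: prox_meet; exists t.
have near A B : s A -> t B -> prox A B by move=> sA tB; apply: st => _ ->.
case: s t st near => [s sc] [t tc] /= _ near.
have st : s = t.
  apply/funext => A; apply/propext; split=> [sA|tA].
  - by apply: (cluster_max tc) => B tB; exact: near.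
  - by apply: (cluster_max sc) => B sB; apply: prox_sym; exact: near.
by move: tc; rewrite -st => tc; rewrite (Prop_irrelevance sc tc).
Qed.

(** In an ultrafilter one of [E], [~` E] is present, which gives that members
    are near each other; maximality holds because the members of the ultrafilter
    themselves belong to the cluster. *)
Lemma ultra_cluster (X : proximityType) (U : set_system X) :
  UltraFilter U -> is_cluster [set A | forall V, U V -> prox A V].
Proof.
move=> UU; have UP : ProperFilter U by exact: ultra_proper.
split.
- exists [set: X] => V UV; apply: prox_meet; rewrite setTI; exact: filter_ex UV.
- move=> A B UA UB; apply: contrapT => /prox_strong[E [AE EB]].
  have [UE|UE] := in_ultra_setVsetC E UU; first by apply: AE; exact: UA.
  by apply: EB; apply: prox_sym; exact: UB.
- move=> C nearC V UV; apply: nearC => W UW.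
  by apply: prox_meet; exact: filter_ex (filterI UV UW).
- move=> A B UAB; apply: contrapT => /not_orP[].
  move=> /existsNP[V /not_implyP[UV AV]] /existsNP[W /not_implyP[UW BW]].
  have UVW : U (V `&` W) by exact: filterI.
  have /prox_sym/proxU[] := UAB _ UVW.
  + by move=> /prox_sym h; apply: AV; apply: prox_sub h => // x [].
  + by move=> /prox_sym h; apply: BW; apply: prox_sub h => // x [].
Qed.

Definition point_cluster {X : proximityType} (x : X) : smirnov X :=
  Cluster (ultra_cluster _ _ (principal_filter_ultra x)).

Lemma point_clusterP {X : proximityType} (x : X) (A : set X) :
  point_cluster x A <-> prox [set x] A.
Proof.
split=> [xA|xA V /principal_filterP Vx].
  by apply: prox_sym; apply: xA; exact/principal_filterP.
by apply: prox_sub (prox_sym xA) => // _ ->.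
Qed.

(** Absorbing point clusters amounts to being near the points, so
    [prox_pointwise] turns a nearness in the space into one in its
    compactification. *)
Lemma smirnov_near_points (X : proximityType) (s : smirnov X) (D : set X) :
  (forall A, s A -> prox A D) -> prox [set s] (point_cluster @` D).
Proof.
move=> sD; apply/smirnov_proxP => A B sA DB; apply: prox_pointwise (sD A _); last exact: sA.
by move=> z Dz; apply/point_clusterP; apply: DB; exists z.
Qed.

Lemma smirnov_near_range_point (X : proximityType) (s : smirnov X) :
  prox [set s] (range (@point_cluster X)).
Proof.
apply: smirnov_near_points => A sA.
exact: (cluster_prox (cluster_sets_is_cluster s)) (cluster_setT _ s).
Qed.

Lemma dense_smirnov (X : proximityType) (F : set (smirnov X)) :
  range (@point_cluster X) `<=` F -> dense (F : set (prox_space (smirnov X))).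
Proof.
move=> pF O [s Os] oO; apply: contrapT => noFO.
apply: (oO s) Os; apply: prox_sub (smirnov_near_range_point X s) => // t /pF Ft Ot.
by apply: noFO; exists t.
Qed.

(** * A map reflecting nearness is an embedding *)

Section ReflectingMap.
Variables (X Y : proximityType) (f : X -> Y).
Hypothesis sepX : separated_prox X.
Hypothesis fP : forall A B, prox (f @` A) (f @` B) <-> prox A B.

Lemma prox_reflecting_inj : injective f.
Proof.
move=> x y fxy; apply/(sepX x y)/fP; rewrite !image_set1 fxy.
by apply: prox_meet; exists (f y).
Qed.

Lemma prox_reflecting_embedding : proximity_embedding f.
Proof.
pose g x : set_type (range f) := SigSub (mem_set (imageT f x)).
have hP (y : set_type (range f)) : exists x, f x = set_val y.
  by have [x _ fx] := set_valP y; exists x.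
pose h y := projT1 (cid (hP y)).
have hK y : f (h y) = set_val y by exact: projT2 (cid (hP y)).
have img (A : set X) : set_val @` (g @` A) = f @` A.
  by rewrite image_comp.
have gh : cancel h g by move=> y; apply: val_inj; exact: hK.
have hg : cancel g h by move=> x; apply: prox_reflecting_inj; exact: hK.
exists (range f), g; split=> //; exists h; split=> // A B.
- by move=> AB; apply/sub_proxP; rewrite !img; exact/fP.
- have fh : f \o h = set_val by apply/funext => y; exact: hK.
  by move=> /sub_proxP AB; apply/fP; rewrite !image_comp fh.
Qed.

Lemma prox_reflecting_isomorphism :
  (forall y, exists x, f x = y) -> proximity_isomorphism f.
Proof.
move=> fS; pose h y := projT1 (cid (fS y)).
have hK : cancel h f by move=> y; exact: projT2 (cid (fS y)).
have Kh : cancel f h by move=> x; apply: prox_reflecting_inj; exact: hK.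
exists h; split=> // A B; first by move/fP.
have fh : f \o h = id by apply/funext => y; exact: hK.
by move=> AB; apply/fP; rewrite !image_comp fh !image_id.
Qed.

End ReflectingMap.

Lemma existT_inj {I : Type} {P : I -> Type} {a : I} {x y : P a} :
  existT P a x = existT P a y -> x = y.
Proof. exact: (@existT_inj2 {classic I}). Qed.

(** * Extending clusters from a summand to the coproduct *)

Section CoproductClusters.
Variables (I : Type) (X : I -> proximityType).

Definition copy (a : I) (A : set (X a)) : set (coproduct X) := existT _ a @` A.

Definition piece (a : I) : set (coproduct X) := [set u | projT1 u = a].

Lemma summand_copy (a : I) (A : set (X a)) : @summand I X (copy a A) a = A.
Proof.
apply/seteqP; split=> x; last by exists x.
by move=> [y Ay /existT_inj <-].
Qed.

Lemma prox_copyl (a : I) (A : set (X a)) (C : set (coproduct X)) :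
  prox (copy a A) C <-> prox A (@summand I X C a).
Proof.
split=> [/coprod_proxP[b]|AC]; last first.
  by apply/coprod_proxP; exists a; rewrite summand_copy.
move=> h; have [[x Ax] _] := prox_nonempty h.
have ab : a = b by case: Ax => y _ e; exact: existT_inj1 e.
by subst b; rewrite summand_copy in h.
Qed.

Lemma extend_is_cluster (a : I) (s : smirnov (X a)) :
  is_cluster [set C | s (@summand I X C a)].
Proof.
have [_ sP sM sU] := cluster_sets_is_cluster s.
split.
- by exists [set: coproduct X]; exact: cluster_setT.
- by move=> A B sA sB; apply/coprod_proxP; exists a; exact: sP.
- move=> C nearC; apply: sM => A sA.
  by apply/prox_sym/prox_copyl/prox_sym/nearC => /=; rewrite summand_copy.
- by move=> A B; exact: sU.
Qed.

Definition coprod_cluster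
    (u : coproduct (fun a => smirnov (X a) : proximityType)) :
    smirnov (coproduct X) :=
  Cluster (extend_is_cluster (projT1 u) (projT2 u)).

(** For the converse direction, sets witnessing farness on the single summands
    are glued into two sets of the coproduct witnessing farness there. *)
Lemma coprod_cluster_prox
    (F G : set (coproduct (fun a => smirnov (X a) : proximityType))) :
  prox (coprod_cluster @` F) (coprod_cluster @` G) <-> prox F G.
Proof.
split=> [FG|/coprod_proxP[a FG]]; last first.
  apply/smirnov_proxP => A B AF BG.
  apply/coprod_proxP; exists a; apply: FG => s Fs.
  - by apply: (AF (coprod_cluster (existT _ a s))); exists (existT _ a s).
  - by apply: (BG (coprod_cluster (existT _ a s))); exists (existT _ a s).
apply: contrapT => nFG.
have far a : exists AB : set (X a) * set (X a),
    [/\ absorbs AB.1 (@summand I _ F a), absorbs AB.2 (@summand I _ G a)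
      & ~ prox AB.1 AB.2].
  apply: contrapT => nAB; apply: nFG; apply/coprod_proxP; exists a.
  apply/smirnov_proxP => A B AF BG.
  by apply: contrapT => AB; apply: nAB; exists (A, B).
pose W a := projT1 (cid (far a)).
have WP a := projT2 (cid (far a)).
have /coprod_proxP[b] :
    prox ([set u | (W (projT1 u)).1 (projT2 u)] : set (coproduct X))
         [set u | (W (projT1 u)).2 (projT2 u)].
  by apply: FG => _ [[a s] Fs <-]; have [AF BG _] := WP a; [exact: AF|exact: BG].
by have [_ _] := WP b.
Qed.

Lemma coprod_smirnov_separated :
  separated_prox (coproduct (fun a => smirnov (X a) : proximityType)).
Proof.
move=> u v; split=> [|->]; last by apply: prox_meet; exists v.
move=> /coprod_proxP[a h]; have [[s us] [t vt]] := prox_nonempty h.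
rewrite -us -vt; congr (existT _ a _); apply/smirnov_separated.
apply: prox_sub h => r /= e.
- by move: e; rewrite -us => /existT_inj.
- by move: e; rewrite -vt => /existT_inj.
Qed.

(** By separation it is enough that members of the two clusters are near, and
    they are, through the point that generates both clusters. *)
Lemma coprod_cluster_point (a : I) (x : X a) :
  coprod_cluster (existT _ a (point_cluster x)) =
  point_cluster (existT _ a x : coproduct X).
Proof.
apply/smirnov_separated/smirnov_proxP => A B.
move=> /(_ _ erefl) /point_clusterP xA /(_ _ erefl).
move=> /point_clusterP xB.
apply: (prox_pointwise _ _ B [set existT _ a x]) => [_ -> //|].
by apply/prox_sym; rewrite -image_set1; exact/prox_copyl.
Qed.

Lemma coprod_cluster_dense :
  dense (range coprod_cluster : set (prox_space (smirnov (coproduct X)))).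
Proof.
apply: dense_smirnov => _ [[a x] _ <-].
by exists (existT _ a (point_cluster x)) => //; exact: coprod_cluster_point.
Qed.

(** * Finite coproducts *)

Lemma cluster_piece (t : smirnov (coproduct X)) :
  finite_set [set: I] -> exists a, t (piece a).
Proof.
move=> /(@finite_seqP {classic I})[r rI].
have: t [set u | (projT1 u : {classic I}) \in r].
  apply: cluster_sub (cluster_setT _ t) => u _.
  by have : [set: I] (projT1 u) by []; rewrite rI.
elim: r {rI} => [|a r IHr] tr.
  have /prox_nonempty[[u //] _] :=
    cluster_prox (cluster_sets_is_cluster t) tr tr.
have : t (piece a `|` [set u | (projT1 u : {classic I}) \in r]).
  apply: cluster_sub tr => u /=; rewrite inE => /orP[/eqP|]; by [left|right].
move=> /(cluster_prime (cluster_sets_is_cluster t))[ta|]; last exact: IHr.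
by exists a.
Qed.

(** A summand is far from its complement, so a cluster containing it is
    determined by the traces of its members on it. *)
Lemma cluster_trace (t : smirnov (coproduct X)) (a : I) (C : set (coproduct X)) :
  t (piece a) -> t (copy a (@summand I X C a)) <-> t C.
Proof.
move=> ta; split=> [|tC]; first by apply: cluster_sub => _ [x Cx <-].
have : t (copy a (@summand I X C a) `|` (C `&` ~` piece a)).
  apply: cluster_sub tC => -[b x] Cx.
  have [ab|ab] := pselect (b = a); last by right.
  by subst b; left; exists x.
move=> /(cluster_prime (cluster_sets_is_cluster t))[//|tN].
have /coprod_proxP[b h] := cluster_prox (cluster_sets_is_cluster t) ta tN.
have [[x /= ab] [y [_ nab]]] := prox_nonempty h.
by case: nab.
Qed.

Lemma trace_is_cluster (t : smirnov (coproduct X)) (a : I) :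
  t (piece a) -> is_cluster [set A | t (copy a A)].
Proof.
move=> ta; have [_ tP tM tU] := cluster_sets_is_cluster t.
split.
- exists [set: X a]; apply/(cluster_trace t a [set: coproduct X] ta).
  exact: cluster_setT.
- by move=> A B tA tB; have /prox_copyl := tP _ _ tA tB; rewrite summand_copy.
- move=> C nearC; apply: tM => D tD.
  by apply/prox_copyl/nearC; exact/cluster_trace.
- by move=> A B /=; rewrite /copy image_setU; exact: tU.
Qed.

Lemma coprod_cluster_surj : finite_set [set: I] ->
  forall t, exists u, coprod_cluster u = t.
Proof.
move=> finI t; have [a ta] := cluster_piece t finI.
exists (existT _ a (Cluster (trace_is_cluster t a ta))).
apply/smirnov_separated/smirnov_proxP => A B.
move=> /(_ _ erefl) /= /(cluster_trace _ _ _ ta) tA.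
by move=> /(_ _ erefl); exact: (cluster_prox (cluster_sets_is_cluster t)).
Qed.

End CoproductClusters.

(** * Infinite coproducts *)

(** A labelling of a Smirnov compactification under which near families share a
    label is a uniformly continuous map to a discrete space; by compactness it
    has finitely many values.  Otherwise, as points already realise all labels,
    the sets of points whose complement carries finitely many labels form a
    proper filter.  Extend it to an ultrafilter and let [b] be the label of the
    resulting cluster: the points with a label other than [b] form a member of
    the ultrafilter, so the cluster is near the family of their point clusters,
    in which the label [b] does not occur. *)
Lemma smirnov_finite_labels (X : proximityType) (I : Type) (p : smirnov X -> I) :
  (forall F G : set (smirnov X), prox F G ->
     exists s t, [/\ F s, G t & p s = p t]) ->
  finite_set (range p).
Proof.
move=> pP; pose q := p \o @point_cluster X.
have qp : range p `<=` range q.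
  move=> _ [s _ <-].
  have [_ [_ [-> [z _ <-] ->]]] := pP _ _ (smirnov_near_range_point X s).
  by exists z.
apply: contrapT => infp.
have infq : ~ finite_set (range q).
  by move=> h; apply: infp; exact: sub_finite_set h.
pose F : set_system X := [set V | finite_set (q @` ~` V)].
have FF : ProperFilter F.
  split; first by rewrite /F /= setC0.
  split.
  - by rewrite /F /= setCT image_set0.
  - by move=> V W FV FW; rewrite /F /= setCI image_setU finite_setU.
  - by move=> V W VW; apply: sub_finite_set; apply: image_subset => x nWx /VW.
have [U [UU FU]] := ultraFilterLemma FF.
pose s := Cluster (ultra_cluster _ _ UU).
pose V := [set z | q z <> p s].
have UV : U V.
  apply: FU; apply: (@sub_finite_set _ _ [set p s]) => //.
  by move=> _ [z /contrapT -> <-].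
have /pP[_ [_ [-> [z Vz <-] e]]] : prox [set s] (point_cluster @` V).
  by apply: smirnov_near_points => A; exact.
exact: Vz (esym e).
Qed.

(** The summand in which the preimage under [g] lies is a labelling of the
    compactification, and nonempty summands make every index a label. *)
Lemma isomorphism_finite_index (I : Type) (Y : I -> proximityType)
    (X : proximityType) (g : coproduct Y -> smirnov X) :
  (forall a, [set: Y a] !=set0) -> proximity_isomorphism g ->
  finite_set [set: I].
Proof.
move=> Y0 [h [gK hK _ hP]].
have : finite_set (range (fun s => projT1 (h s))).
  apply: smirnov_finite_labels => F G /hP/coprod_proxP[a FG].
  have [[x [s Fs hs]] [y [t Gt ht]]] := prox_nonempty FG.
  by exists s, t; rewrite hs ht.
apply: sub_finite_set => a _; have [y _] := Y0 a.
by exists (g (existT _ a y)) => //; rewrite gK.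
Qed.

Theorem theorem4p1 (I : Type) (X : I -> proximityType)
    (sepX : forall a : I, separated_prox (X a)) :
  exists f : coproduct (fun a : I => smirnov (X a) : proximityType) ->
             smirnov (coproduct X),
    [/\ dense_proximity_embedding f,
        finite_set [set: I] -> proximity_isomorphism f
      & (forall a : I, [set: X a] !=set0) ->
        (proximity_isomorphism f <-> finite_set [set: I]) /\
        ((exists g : coproduct (fun a : I => smirnov (X a) : proximityType) ->
                     smirnov (coproduct X), proximity_isomorphism g)
          <-> finite_set [set: I])].
Proof.
have sep := coprod_smirnov_separated I X.
have fP := coprod_cluster_prox I X.
have finP : finite_set [set: I] -> proximity_isomorphism (coprod_cluster I X).
  move=> finI; apply: prox_reflecting_isomorphism => //.
  exact: coprod_cluster_surj.
exists (coprod_cluster I X); split=> //.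
  by split; [exact: prox_reflecting_embedding|exact: coprod_cluster_dense].
move=> X0.
have isoP g : @proximity_isomorphism
    (coproduct (fun a : I => smirnov (X a) : proximityType))
    (smirnov (coproduct X)) g -> finite_set [set: I].
  apply: isomorphism_finite_index => a.
  by have [x _] := X0 a; exists (point_cluster x).
split; split=> [|finI]; [exact: isoP|exact: finP|by move=> [g /isoP]|].
by exists (coprod_cluster I X); exact: finP.
Qed.
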